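(* Let $m\ge 2$ be an integer, $A,B\in\mathbb{Z}_m$, and let $\{F_n\}_{n=0}^\infty$ be a sequence in $\mathbb{Z}_m$. The equation $$BX_{n+1}=AX_n+F_n,\quad n\in\mathbb{Z}_+,$$ has a unique solution $\{X_n\}_{n=0}^\infty$ in $\mathbb{Z}_m$ if and only if $A$ is invertible and $B$ is nilpotent in $\mathbb{Z}_m$. Moreover, this solution has the form $$X_n=-\sum_{s=0}^{\mathrm{ind}(B)-1}A^{-s-1}B^sF_{n+s},\quad n\in\mathbb{Z}_+.$$
   Context: $\mathbb{Z}_+$ is the set of non-negative integers and $\mathbb{Z}_m=\mathbb{Z}/m\mathbb{Z}$. For a nilpotent element $T$, $\mathrm{ind}(T)$ is its nilpotency index (least $k\ge1$ with $T^k=0$). Zeroth powers are $1$. *)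

(* Defs.v *)
From mathcomp Require Import all_boot all_order all_algebra.

Set Implicit Arguments.
Unset Strict Implicit.
Unset Printing Implicit Defensive.

Import GRing.Theory.
Local Open Scope ring_scope.

Definition nilpotent_elt (R : nzRingType) (T : R) : Prop :=
  exists k : nat, (0 < k)%N && (T ^+ k == 0).

Definition nilp_index (R : nzRingType) (T : R) (nilT : nilpotent_elt T) : nat :=
  ex_minn nilT.

Definition is_solution (R : nzRingType) (A B : R) (F X : nat -> R) : Prop :=
  forall n : nat, B * X n.+1 = A * X n + F n.

(* Main.v *)
(* Solving the equation for [X_n] and iterating [k] times leaves the remainder
   [A^(-k) B^k X_(n+k)], which vanishes when [B^k = 0]. Conversely, uniqueness
   forces the homogeneous equation to have only the zero solution. If [A] is
   not a unit of a finite ring, it kills some [c != 0], and [c, 0, 0, ...] is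
   a homogeneous solution. By finiteness [B^(i+p+1) = B^i] for some [i, p], and
   [Y_n = (A B^p)^n B^i] is a homogeneous solution, so [B^i = Y_0 = 0]. *)
Require Import Defs.
From mathcomp Require Import all_boot all_order all_algebra.
From mathcomp Require Import ring.
From Stdlib Require Import FunctionalExtensionality.

Set Implicit Arguments.
Unset Strict Implicit.
Unset Printing Implicit Defensive.

Import GRing.Theory.
Local Open Scope ring_scope.

Section ComUnitRing.
Variable R : comUnitRingType.
Implicit Types (A B : R) (F X : nat -> R).

(** The length [k] is left free, so that the formula applies to every exponent that kills [B], the
    nilpotency index among them. *)
Definition backward_sum A B F (k n : nat) : R :=
  - \sum_(0 <= s < k) A ^- s.+1 * B ^+ s * F (n + s)%N.

Lemma solution_iter A B F X k n :
  A \is a GRing.unit -> is_solution A B F X ->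
  X n = A ^- k * B ^+ k * X (n + k)%N + backward_sum A B F k n.
Proof.
move=> uA solX; rewrite /backward_sum; elim: k => [|k IHk].
  by rewrite big_geq // oppr0 addr0 !expr0 invr1 !mul1r addn0.
rewrite big_nat_recr //= {1}IHk addnS.
(* The equation trades [B * X (n + k).+1] for the remainder at [k] and the summand of index [k]. *)
have -> : A ^- k.+1 * B ^+ k.+1 * X (n + k).+1
    = A ^- k.+1 * B ^+ k * (A * X (n + k)%N + F (n + k)%N).
  by rewrite -solX [B ^+ k.+1]exprSr; ring.
have -> : A ^- k = A ^- k.+1 * A.
  by rewrite -!exprVn exprSr -mulrA mulVr // mulr1.
ring.
Qed.

Lemma solution_backward_sum A B F X k n :
  A \is a GRing.unit -> B ^+ k = 0 -> is_solution A B F X ->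
  X n = backward_sum A B F k n.
Proof.
move=> uA Bk0 solX.
by rewrite (solution_iter k n uA solX) Bk0 mulr0 mul0r add0r.
Qed.

(** After an index shift the two sums agree term by term, except for the last term on the left,
    which contains [B ^+ k.+1], and the term [s = 0] on the right, which cancels [F n]. *)
Lemma backward_sum_solution A B F k :
  A \is a GRing.unit -> B ^+ k.+1 = 0 ->
  is_solution A B F (backward_sum A B F k.+1).
Proof.
move=> uA Bk0 n; rewrite /backward_sum !mulrN !mulr_sumr.
rewrite big_nat_recr //= [X in _ = - X + _]big_nat_recl //=.
rewrite expr0 expr1 mulr1 addn0 mulVKr //.
have -> : B * (A ^- k.+1 * B ^+ k * F (n.+1 + k)%N) = 0.
  by rewrite mulrA [B * _]mulrCA -exprS Bk0 mulr0 mul0r.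
rewrite addr0 opprD addrAC addNr add0r; congr (- _).
apply: eq_bigr => s _; rewrite addSnnS.
have -> : A ^- s.+1 = A * A ^- s.+2.
  by rewrite -!exprVn [A^-1 ^+ s.+2]exprS mulrA mulrV // mul1r.
by rewrite [B ^+ s.+1]exprS; ring.
Qed.

(** Adding [Y] to the solution [X] gives a solution again, so [X + Y = X]. *)
Lemma unique_solution_homogeneous A B F Y n :
  (exists! X, is_solution A B F X) -> is_solution A B (fun=> 0) Y -> Y n = 0.
Proof.
move=> [X [solX uniqX]] solY.
have /uniqX/(congr1 (fun Z => Z n)) : is_solution A B F (fun k => X k + Y k).
  by move=> k; rewrite mulrDr solX solY; ring.
by move/esym/eqP; rewrite -subr_eq0 addrAC subrr add0r => /eqP.
Qed.

End ComUnitRing.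

(** Pigeonhole on the first [#|R| + 1] powers of [B]. *)
Lemma finite_expr_periodic (R : finNzRingType) (B : R) :
  exists i p : nat, B ^+ (i + p.+1) = B ^+ i.
Proof.
pose f (i : 'I_#|R|.+1) := B ^+ i.
have /injectivePn[i [j neq_ij eq_f]] : ~~ injectiveb f.
  apply/negP => /injectiveP/leq_card; by rewrite card_ord ltnn.
wlog lt_ij : i j neq_ij eq_f / (i < j)%N.
  move=> W; have [/W|/W|/val_inj eq_ij] := ltngtP i j; first exact.
    by apply; rewrite // eq_sym.
  by rewrite eq_ij eqxx in neq_ij.
by exists i, (j - i.+1)%N; rewrite addnS -addSn subnKC // -[RHS]eq_f.
Qed.

(** Multiplication by [A] is injective, hence bijective on a finite ring, and the preimage of 1
    inverts [A]. *)
Lemma finite_lregular_unit (R : finComUnitRingType) (A : R) :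
  (forall c, A * c = 0 -> c = 0) -> A \is a GRing.unit.
Proof.
move=> regA; have injA : injective ( *%R A).
  move=> x y /eqP; rewrite -subr_eq0 -mulrBr => /eqP/regA/eqP.
  by rewrite subr_eq0 => /eqP.
have AV : A * invF injA 1 = 1 := f_invF injA 1.
by apply/unitrPr; exists (invF injA 1).
Qed.

Lemma unique_solution_unit (R : finComUnitRingType) (A B : R) (F : nat -> R) :
  (exists! X, is_solution A B F X) -> A \is a GRing.unit.
Proof.
move=> uniqX; apply: finite_lregular_unit => c Ac0.
apply: (unique_solution_homogeneous (Y := fun n => if n is 0 then c else 0)
          0 uniqX).
by case=> [|n] /=; rewrite ?Ac0 !mulr0 addr0.
Qed.

Lemma unique_solution_nilpotent (R : finComUnitRingType) (A B : R)
    (F : nat -> R) :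
  (exists! X, is_solution A B F X) -> nilpotent_elt B.
Proof.
move=> uniqX; have [i [p periodB]] := finite_expr_periodic B.
(* Here [i] may be 0 while the exponent must be positive, hence [i.+1]. *)
suff Bi0 : B ^+ i = 0 by exists i.+1; rewrite exprS Bi0 mulr0 eqxx.
pose Y n := (A * B ^+ p) ^+ n * B ^+ i.
suff solY : is_solution A B (fun=> 0) Y.
  by have := unique_solution_homogeneous 0 uniqX solY; rewrite /Y mul1r.
(* Writing [B ^+ i] on the right as [B ^+ (i + p.+1)] supplies the extra factors [B] and [B ^+ p] of
   the left side. *)
move=> n; rewrite /Y -{2}periodB addr0 exprD !exprS; ring.
Qed.

Theorem corollary3p3 (m : nat) (m_ge2 : (2 <= m)%N) (A B : 'Z_m)
    (F : nat -> 'Z_m) :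
  ((exists! X : nat -> 'Z_m, is_solution A B F X) <->
     (A \is a GRing.unit /\ nilpotent_elt B)) /\
  (forall (unitA : A \is a GRing.unit) (nilB : nilpotent_elt B)
      (X : nat -> 'Z_m), is_solution A B F X ->
    forall n : nat,
      X n = - \sum_(0 <= s < nilp_index nilB) A ^- s.+1 * B ^+ s * F (n + s)%N).
Proof.
split; last first.
  move=> uA nilB X solX n; apply: solution_backward_sum => //.
  by rewrite /nilp_index; case: ex_minnP => k /andP[_ /eqP].
split=> [uniqX|[uA [[//|k] /= /eqP Bk0]]].
  split; first exact: unique_solution_unit uniqX.
  exact: unique_solution_nilpotent uniqX.
exists (backward_sum A B F k.+1); split; first exact: backward_sum_solution.
move=> X solX; apply: functional_extensionality => n.
exact/esym/solution_backward_sum.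
Qed.
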